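(* Let $n\ge 2$, let $P=(p_1,\dots,p_n),\,Q=(q_1,\dots,q_n)\in\Gamma_n$, and let $r,R$ be real numbers with $0<r<1<R<\infty$ and $r\le \frac{p_i}{q_i}\le R$ for all $i\in\{1,\dots,n\}$. Let $s\in\mathbb{R}$. Then $$\Omega_s(P\|Q)\le E_{\Omega_s}(P\|Q)\le A_{\Omega_s}(r,R)$$ and $$\Omega_s(P\|Q)\le B_{\Omega_s}(r,R)\le A_{\Omega_s}(r,R),$$ where $$E_{\Omega_s}(P\|Q)=\begin{cases}\dfrac{1}{s(s-1)}\displaystyle\sum_{i=1}^n\left(\frac{p_i-q_i}{p_i+q_i}\right)\left(\frac{p_i+q_i}{2p_i}\right)^s\left[p_i+(1-s)q_i\right], & s\ne 0,1,\\[2mm] D(Q\|P)-\frac12\Delta(P\|Q), & s=0,\\[1mm] \frac12\left[\chi^2(Q\|P)-D(Q\|P)\right], & s=1,\end{cases}$$ $$A_{\Omega_s}(r,R)=\frac{(R-r)^2}{4rR}\,2^{-s}\left\{L_{s-1}^{s-1}\left(\frac{r+1}{r},\frac{R+1}{R}\right)-L_{s-2}^{s-2}\left(\frac{r+1}{r},\frac{R+1}{R}\right)\right\},$$ and $$B_{\Omega_s}(r,R)=\frac{1}{2(s-1)}L_{s-1}^{s-1}\left(\frac{r+1}{2r},\frac{R+1}{2R}\right)+\frac{1}{s(s-1)(R-r)}\left\{R\left[\left(\frac{R+1}{2R}\right)^s-1\right]-r\left[\left(\frac{r+1}{2r}\right)^s-1\right]\right\}\quad\text{if } s\ne 0,1,$$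 $$B_{\Omega_0}(r,R)=\frac{1}{R-r}\left[r\ln\left(\frac{r+1}{2r}\right)-R\ln\left(\frac{R+1}{2R}\right)\right]-\frac12L_{-1}^{-1}\left(\frac{r+1}{2r},\frac{R+1}{2R}\right),$$ $$B_{\Omega_1}(r,R)=\frac{rR-1}{4rR}L_{-1}^{-1}\left(\frac{r+1}{2r},\frac{R+1}{2R}\right)+\frac12\ln\left(\frac{(R+1)(r+1)}{4rR}\right).$$
   Context: $\Gamma_n=\{(p_1,\dots,p_n): p_i>0,\ \sum_{i=1}^n p_i=1\}$, $n\ge 2$. For $P,Q\in\Gamma_n$ and $s\in\mathbb{R}$, the unified relative AG and JS divergence of type $s$ is $$\Omega_s(P\|Q)=\begin{cases}\dfrac{1}{s(s-1)}\left[\displaystyle\sum_{i=1}^n p_i\left(\frac{p_i+q_i}{2p_i}\right)^s-1\right], & s\ne0,1,\\ \displaystyle\sum_{i=1}^n p_i\ln\left(\frac{2p_i}{p_i+q_i}\right), & s=0,\\ \displaystyle\sum_{i=1}^n\left(\frac{p_i+q_i}{2}\right)\ln\left(\frac{p_i+q_i}{2p_i}\right), & s=1.\end{cases}$$ Other divergences: $\chi^2(P\|Q)=\sum_{i=1}^n\frac{(p_i-q_i)^2}{q_i}$ (so $\chi^2(Q\|P)=\sum_{i=1}^n\frac{(p_i-q_i)^2}{p_i}$); $D(P\|Q)=\sum_{i=1}^n(p_i-q_i)\ln\left(\frac{p_i+q_i}{2q_i}\right)$ (so $D(Q\|P)=\sum_{i=1}^n(q_i-p_i)\ln\left(\frac{p_i+q_i}{2p_i}\right)$);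 $\Delta(P\|Q)=\sum_{i=1}^n\frac{(p_i-q_i)^2}{p_i+q_i}$. For $a,b>0$, $a\ne b$ and $p\in\mathbb{R}$: $L_p^p(a,b)=\frac{b^{p+1}-a^{p+1}}{(p+1)(b-a)}$ if $p\ne-1$ (in particular $L_0^0(a,b)=1$), and $L_{-1}^{-1}(a,b)=\frac{\ln b-\ln a}{b-a}$. *)

(* Defs.v *)
From HB Require Import structures.
From mathcomp Require Import all_boot all_order all_algebra.
From mathcomp Require Import all_classical all_reals all_analysis.

Set Implicit Arguments.
Unset Strict Implicit.
Unset Printing Implicit Defensive.

Import Order.TTheory GRing.Theory Num.Theory.
Local Open Scope classical_set_scope.
Local Open Scope ring_scope.

Definition Gamma (K : realType) (n : nat) : set ('I_n -> K) :=
  [set p | (forall i, 0 < p i) /\ \sum_(i < n) p i = 1].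
Arguments Gamma : clear implicits.

(** The divergences below are total functions; they have their intended meaning
    for [P] and [Q] in [Gamma K n], where no denominator vanishes and every
    argument of [ln] and every base of [`^] is positive. *)

Definition chi2 (K : realType) (n : nat) (P Q : 'I_n -> K) : K :=
  \sum_(i < n) (P i - Q i) ^+ 2 / Q i.

Definition Ddiv (K : realType) (n : nat) (P Q : 'I_n -> K) : K :=
  \sum_(i < n) (P i - Q i) * ln ((P i + Q i) / (2 * Q i)).

Definition Delta (K : realType) (n : nat) (P Q : 'I_n -> K) : K :=
  \sum_(i < n) (P i - Q i) ^+ 2 / (P i + Q i).

Definition Omega (K : realType) (s : K) (n : nat) (P Q : 'I_n -> K) : K :=
  if s == 0 then
    \sum_(i < n) P i * ln (2 * P i / (P i + Q i))
  else if s == 1 then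
    \sum_(i < n) (P i + Q i) / 2 * ln ((P i + Q i) / (2 * P i))
  else
    (s * (s - 1))^-1 *
      (\sum_(i < n) P i * ((P i + Q i) / (2 * P i)) `^ s - 1).

(** [Lpow p a b] is the [p]-th power L_p^p(a, b) of the generalized logarithmic
    mean L_p(a, b), for [a], [b] positive and distinct. *)
Definition Lpow (K : realType) (p a b : K) : K :=
  if p == -1 then (ln b - ln a) / (b - a)
  else (b `^ (p + 1) - a `^ (p + 1)) / ((p + 1) * (b - a)).

Definition EOmega (K : realType) (s : K) (n : nat) (P Q : 'I_n -> K) : K :=
  if s == 0 then Ddiv Q P - 2^-1 * Delta P Q
  else if s == 1 then 2^-1 * (chi2 Q P - Ddiv Q P)
  else
    (s * (s - 1))^-1 *
      \sum_(i < n) (P i - Q i) / (P i + Q i)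
                   * ((P i + Q i) / (2 * P i)) `^ s
                   * (P i + (1 - s) * Q i).

Definition AOmega (K : realType) (s r R : K) : K :=
  (R - r) ^+ 2 / (4 * r * R) * 2 `^ (- s) *
    (Lpow (s - 1) ((r + 1) / r) ((R + 1) / R)
     - Lpow (s - 2) ((r + 1) / r) ((R + 1) / R)).

Definition BOmega (K : realType) (s r R : K) : K :=
  if s == 0 then
    (R - r)^-1 * (r * ln ((r + 1) / (2 * r)) - R * ln ((R + 1) / (2 * R)))
    - 2^-1 * Lpow (-1) ((r + 1) / (2 * r)) ((R + 1) / (2 * R))
  else if s == 1 then
    (r * R - 1) / (4 * r * R)
      * Lpow (-1) ((r + 1) / (2 * r)) ((R + 1) / (2 * R))
    + 2^-1 * ln ((R + 1) * (r + 1) / (4 * r * R))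
  else
    (2 * (s - 1))^-1
      * Lpow (s - 1) ((r + 1) / (2 * r)) ((R + 1) / (2 * R))
    + (s * (s - 1) * (R - r))^-1
      * (R * (((R + 1) / (2 * R)) `^ s - 1)
         - r * (((r + 1) / (2 * r)) `^ s - 1)).

(* Main.v *)
Require Import Defs.
From mathcomp Require Import all_boot all_order all_algebra ring lra.
From mathcomp Require Import all_classical all_reals all_analysis.

Import Order.TTheory GRing.Theory Num.Theory.
Local Open Scope classical_set_scope.
Local Open Scope ring_scope.

(** [Omega s P Q] is the Csiszar divergence
    [\sum_i q_i * f (p_i / q_i)] of the generator
    [f u = u * phi_s ((u + 1) / (2 * u))], where [phi_s] vanishes at 1 and
    has the second derivative [w `^ (s - 2)].  The weights [q_i] and
    the points [u_i = p_i / q_i] form a probability distribution on [[r, R]]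
    with mean 1, and [f 1 = 0].  Writing [df] for the derivative of [f], the
    other quantities are
    - [EOmega = \sum_i q_i * (u_i - 1) * df u_i] (lemma [EOmegaE]),
    - [BOmega], the value at 1 of the chord of [f] over [[r, R]] ([BOmegaE]),
    - [AOmega = (R - r) * (df R - df r) / 4] ([AOmegaE]).

    Convexity of [f] now gives everything.  The tangent at [u_i] evaluated at 1
    gives [Omega <= EOmega]; the graph of [f] lies below its chord, so
    [Omega <= BOmega].  Both bounds by [AOmega] have the same shape: [EOmega]
    is the covariance of [u_i] and [df u_i], which range over intervals of
    length [R - r] and [df R - df r], and Gruess' inequality bounds such a
    covariance by a quarter of the product of the lengths; and the tangents at
    [r] and [R] evaluated at 1 bound [BOmega] by
    [(R - 1) * (1 - r) * (df R - df r) / (R - r)], whence the quarter by the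
    inequality between arithmetic and geometric means.

    Convexity enters only as the inequality [f x + df x * (y - x) <= f y].  For
    [f] it follows from the same inequality for [phi_s], because [f] is the
    perspective [u * phi_s (1 / 2 + 1 / (2 * u))]; for [phi_s] it is
    Bernoulli's inequality with a real exponent, a consequence of
    [1 + x <= expR x].  No differentiation is involved. *)

(** * The inequality of Gruess *)

(** The covariance is unchanged when a constant is subtracted from [v]; for the
    constant below Gruess' inequality already holds pointwise.  With [u] and
    [v] rescaled to [x] and [y] in [[-1/2, 1/2]] and [x0] the offset of the
    rescaled mean, [(x + x0) * (y - x0) <= ((x + y) / 2) ^+ 2 <= 1 / 4]: the
    constant makes the two offsets cancel in the sum. *)
Lemma gruss_pointwise (K : realFieldType) (r R m M mu u v : K) :
  r < R -> m < M -> r <= u <= R -> m <= v <= M ->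
  (u - mu) * (v - ((m + M) / 2 + ((r + R) / 2 - mu) * (M - m) / (R - r)))
    <= (R - r) * (M - m) / 4.
Proof.
move=> rR mM /andP[ru uR] /andP[mv vM].
have D0 : 0 < R - r by rewrite subr_gt0.
have d0 : 0 < M - m by rewrite subr_gt0.
pose x := (u - (r + R) / 2) / (R - r).
pose y := (v - (m + M) / 2) / (M - m).
pose x0 := ((r + R) / 2 - mu) / (R - r).
have hx : - (1 / 2) <= x <= 1 / 2.
  by rewrite /x ler_pdivlMr // ler_pdivrMr //; apply/andP; split; lra.
have hy : - (1 / 2) <= y <= 1 / 2.
  by rewrite /y ler_pdivlMr // ler_pdivrMr //; apply/andP; split; lra.
have -> : (u - mu) * (v - ((m + M) / 2 + ((r + R) / 2 - mu) * (M - m) / (R - r)))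
  = (R - r) * (M - m) * ((x + x0) * (y - x0)).
  by rewrite /x /y /x0; field; rewrite !gt_eqF.
rewrite ler_pM2l ?mulr_gt0 //.
have h1 : (x + x0) * (y - x0) <= (x + y) ^+ 2 / 4.
  have := sqr_ge0 ((x + x0) - (y - x0)); nra.
have h2 : (x + y) ^+ 2 <= 1 by nra.
lra.
Qed.

(** The left-hand side is the covariance of [u] and [v] under the weights [q]. *)
Lemma gruss (K : realFieldType) (n : nat) (q u v : 'I_n -> K) (r R m M mu : K) :
  (forall i, 0 <= q i) -> \sum_i q i = 1 -> \sum_i q i * u i = mu ->
  r < R -> m <= M ->
  (forall i, r <= u i <= R) -> (forall i, m <= v i <= M) ->
  \sum_i q i * ((u i - mu) * v i) <= (R - r) * (M - m) / 4.
Proof.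
move=> q0 q1 qu rR mM hu hv.
have shift c : \sum_i q i * ((u i - mu) * v i)
             = \sum_i q i * ((u i - mu) * (v i - c)).
  have -> : \sum_i q i * ((u i - mu) * (v i - c))
    = \sum_i (q i * ((u i - mu) * v i) - (q i * u i - q i * mu) * c).
    by apply: eq_bigr => i _; ring.
  by rewrite sumrB -mulr_suml sumrB qu -mulr_suml q1 mul1r subrr mul0r subr0.
(* If [m = M] the pointwise constant is undefined, but [v] is constant. *)
move: mM; rewrite le_eqVlt => /predU1P[mM|mM].
  rewrite (shift m) big1 => [|i _].
    by rewrite mM subrr mulr0 mul0r.
  suff -> : v i = m by rewrite subrr !mulr0.
  by apply/le_anti; rewrite andbC {2}mM hv.
rewrite (shift ((m + M) / 2 + ((r + R) / 2 - mu) * (M - m) / (R - r))).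
rewrite [leRHS](_ : _ = \sum_i q i * ((R - r) * (M - m) / 4)); last first.
  by rewrite -mulr_suml q1 mul1r.
apply: ler_sum => i _.
by apply: ler_wpM2l => //; apply: gruss_pointwise.
Qed.

(** * Convexity through supporting lines *)

(** Convexity on the positive half-line, in the form of supporting lines with
    slopes [df]. *)
Definition subgradient_on_pos {K : realFieldType} (f df : K -> K) :=
  forall x y : K, 0 < x -> 0 < y -> f x + df x * (y - x) <= f y.

Lemma subgradient_homo (K : realFieldType) (f df : K -> K) :
  subgradient_on_pos f df ->
  forall x y, 0 < x -> x <= y -> df x <= df y.
Proof.
move=> tf x y x0; rewrite le_eqVlt => /predU1P[->//|xy].
have y0 := lt_trans x0 xy.
have := tf x y x0 y0; have := tf y x y0 x0; nra.
Qed.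

Lemma mean_ratio_gt0 (K : realFieldType) (z : K) : 0 < z -> 0 < (z + 1) / (2 * z).
Proof. by move=> z0; rewrite divr_gt0 ?addr_gt0 ?mulr_gt0. Qed.

(** The perspective [u * phi (1 / 2 + 1 / (2 * u))] of a convex function is
    convex: multiply the tangent inequality of [phi] between the two arguments
    by [y], and [y * (1 / (2 * y) - 1 / (2 * x))] becomes affine in [y]. *)
Lemma subgradient_perspective (K : realFieldType) (phi dphi : K -> K) :
  subgradient_on_pos phi dphi ->
  subgradient_on_pos (fun u => u * phi ((u + 1) / (2 * u)))
    (fun u => phi ((u + 1) / (2 * u)) - dphi ((u + 1) / (2 * u)) / (2 * u)).
Proof.
move=> tphi x y x0 y0.
have := tphi _ _ (mean_ratio_gt0 _ _ x0) (mean_ratio_gt0 _ _ y0).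
rewrite -(ler_pM2l y0); apply: le_trans.
by rewrite le_eqVlt; apply/predU1P; left; field; rewrite !gt_eqF.
Qed.

(** * Bounds for Csiszar divergences *)

Section FDivergence.
Variables (K : realFieldType) (n : nat) (q u : 'I_n -> K) (r R : K).
Variables (f df : K -> K).
Hypotheses (q0 : forall i, 0 < q i) (q1 : \sum_i q i = 1).
Hypotheses (qu : \sum_i q i * u i = 1).
Hypotheses (r0 : 0 < r) (r1 : r < 1) (R1 : 1 < R).
Hypothesis hu : forall i, r <= u i <= R.
Hypotheses (tf : subgradient_on_pos f df) (f1 : f 1 = 0).

Let rR : r < R := lt_trans r1 R1.
Let R0 : 0 < R := lt_trans r0 rR.
Let u0 i : 0 < u i.
Proof. by have /andP[+ _] := hu i; apply: lt_le_trans. Qed.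

(** The tangent of [f] at [u i], evaluated at the mean 1 where [f] vanishes. *)
Lemma fdiv_le_gradient :
  \sum_i q i * f (u i) <= \sum_i q i * ((u i - 1) * df (u i)).
Proof.
apply: ler_sum => i _; apply: ler_wpM2l; first exact: ltW.
have := tf _ _ (u0 i) ltr01; rewrite f1; lra.
Qed.

(** Since the mean of [u] is 1, the left-hand side is the covariance of [u] and
    [df u], and [df] is monotone. *)
Lemma gradient_le_gruss :
  \sum_i q i * ((u i - 1) * df (u i)) <= (R - r) * (df R - df r) / 4.
Proof.
have mono := subgradient_homo _ _ _ tf.
apply: gruss => // [i||i]; [exact: ltW|by apply: mono; rewrite ?ltW|].
by have /andP[ru uR] := hu i; rewrite !mono.
Qed.

(** The chord of [f] over [[r, R]] lies above [f]; it is affine, so averaging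
    it against [q] evaluates it at the mean 1. *)
Lemma fdiv_le_chord :
  \sum_i q i * f (u i) <= ((R - 1) * f r + (1 - r) * f R) / (R - r).
Proof.
have D0 : 0 < R - r by rewrite subr_gt0.
have chord i : f (u i) <= ((R - u i) * f r + (u i - r) * f R) / (R - r).
  have /andP[ru uR] := hu i.
  rewrite ler_pdivlMr //.
  have h1 := tf _ _ (u0 i) r0; have h2 := tf _ _ (u0 i) R0.
  have : (R - u i) * (f (u i) + df (u i) * (r - u i)) <= (R - u i) * f r.
    by rewrite ler_wpM2l ?subr_ge0.
  have : (u i - r) * (f (u i) + df (u i) * (R - u i)) <= (u i - r) * f R.
    by rewrite ler_wpM2l ?subr_ge0.
  nra.
apply: (@le_trans _ _
  (\sum_i (q i * ((R * f r - r * f R) / (R - r))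
           + q i * u i * ((f R - f r) / (R - r))))).
  apply: ler_sum => i _; apply: (le_trans (ler_wpM2l (ltW (q0 i)) (chord i))).
  by rewrite le_eqVlt; apply/predU1P; left; ring.
rewrite big_split /= -!mulr_suml q1 qu !mul1r.
by rewrite le_eqVlt; apply/predU1P; left; ring.
Qed.

(** The tangents at the end points bound [f r] and [f R], and
    [(R - 1) * (1 - r) <= ((R - r) / 2) ^+ 2]. *)
Lemma chord_le_gruss :
  ((R - 1) * f r + (1 - r) * f R) / (R - r) <= (R - r) * (df R - df r) / 4.
Proof.
have D0 : 0 < R - r by rewrite subr_gt0.
have ddf : 0 <= df R - df r.
  by rewrite subr_ge0; apply: subgradient_homo _ _ _ tf _ _ _ _; rewrite ?ltW.
have fr : f r <= (r - 1) * df r.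
  by have := tf _ _ r0 ltr01; rewrite f1; lra.
have fR : f R <= (R - 1) * df R.
  by have := tf _ _ R0 ltr01; rewrite f1; lra.
rewrite ler_pdivrMr //.
have h1 : (R - 1) * f r + (1 - r) * f R <= (R - 1) * (1 - r) * (df R - df r).
  have : (R - 1) * f r <= (R - 1) * ((r - 1) * df r).
    by rewrite ler_pM2l // subr_gt0.
  have : (1 - r) * f R <= (1 - r) * ((R - 1) * df R).
    by rewrite ler_pM2l // subr_gt0.
  lra.
apply: (le_trans h1).
have h2 : (R - 1) * (1 - r) <= (R - r) ^+ 2 / 4.
  have := sqr_ge0 ((R - 1) - (1 - r)); nra.
apply: (le_trans (ler_wpM2r ddf h2)).
by rewrite le_eqVlt; apply/predU1P; left; ring.
Qed.

End FDivergence.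

(** * The generator of the divergence *)

Section Generator.
Context {K : realType}.
Implicit Types s p a b c r R u w x y z : K.

(** The second derivative of [phi s] is [w `^ (s - 2)] in all three cases. *)
Definition phi s w : K :=
  if s == 0 then - ln w
  else if s == 1 then w * ln w
  else (w `^ s - 1) / (s * (s - 1)).

(** The case [s = 0] of the derivative, [- w^-1], is covered by the generic
    formula. *)
Definition dphi s w : K :=
  if s == 1 then ln w + 1 else w `^ (s - 1) / (s - 1).

Definition Omega_gen s u : K := u * phi s ((u + 1) / (2 * u)).

Definition Omega_dgen s u : K :=
  phi s ((u + 1) / (2 * u)) - dphi s ((u + 1) / (2 * u)) / (2 * u).

Lemma ln_le_subr1 x : 0 < x -> ln x <= x - 1.
Proof.
move=> x0; rewrite -[x in ln x](subrKC 1).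
by apply: le_ln1Dx; lra.
Qed.

Lemma powR_subr1 x s : 0 < x -> x `^ (s - 1) = x `^ s / x.
Proof.
move=> x0; rewrite powRB ?powRr1 ?ltW //.
by apply/implyP => _; rewrite gt_eqF.
Qed.

(** Bernoulli's inequality [t `^ s - 1 >= s * (t - 1)], reversed for
    [0 < s < 1], at [t = expR z].  In each range of [s] it is a nonnegative
    combination of two instances of [1 + x <= expR x], scaled by [expR z] when
    [1 < s] and by [expR (s * z)] when [0 < s < 1]. *)
Lemma expR_bernoulli s z : s != 0 -> s != 1 ->
  0 <= (expR (s * z) - 1 - s * (expR z - 1)) / (s * (s - 1)).
Proof.
move=> s0 s1.
have e1 : expR (s * z) = expR z * expR ((s - 1) * z).
  by rewrite -expRD; congr expR; ring.
have e2 : 1 = expR z * expR (- z) by rewrite -expRD subrr expR0.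
have e3 : expR z = expR (s * z) * expR ((1 - s) * z).
  by rewrite -expRD; congr expR; ring.
have e4 : 1 = expR (s * z) * expR (- s * z).
  by rewrite -expRD mulNr subrr expR0.
have E := expR_gt0 z; have Es := expR_gt0 (s * z).
have [sn|sp|/eqP] := ltgtP s 0; last by rewrite (negbTE s0).
  apply: divr_ge0; last by rewrite nmulr_rge0 // subr_le0; lra.
  have := expR_ge1Dx (s * z); have := expR_ge1Dx z; nra.
have [sl|sg|/eqP] := ltgtP s 1; last by rewrite (negbTE s1).
  apply: mulr_le0; last by rewrite invr_le0 pmulr_rle0 // subr_le0 ltW.
  have : expR (s * z) * (1 + (1 - s) * z) <= expR z.
    by rewrite e3 ler_pM2l // expR_ge1Dx.
  have : expR (s * z) * (1 + - s * z) <= 1.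
    by rewrite [leRHS]e4 ler_pM2l // expR_ge1Dx.
  have sl0 : 0 <= 1 - s by rewrite subr_ge0 ltW.
  move=> /(ler_wpM2l sl0) h2 /(ler_wpM2l (ltW sp)) h1; lra.
apply: divr_ge0; last by rewrite mulr_ge0 ?subr_ge0 ?ltW.
have : expR z * (1 + (s - 1) * z) <= expR (s * z).
  by rewrite e1 ler_pM2l // expR_ge1Dx.
have : expR z * (1 + - z) <= 1 by rewrite [leRHS]e2 ler_pM2l // expR_ge1Dx.
have sg0 : 0 <= s - 1 by rewrite subr_ge0 ltW.
move=> /(ler_wpM2l sg0); lra.
Qed.

(** By homogeneity the inequality depends on [y / x] only. *)
Lemma phi_subgradient s : subgradient_on_pos (phi s) (dphi s).
Proof.
move=> x y x0 y0; rewrite /phi /dphi.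
have [->|s0] := eqVneq s 0.
  rewrite eq_sym oner_eq0 sub0r powR_inv1 ?(ltW x0) //.
  have := ln_le_subr1 (y / x) (divr_gt0 y0 x0).
  rewrite ln_div // => h.
  have -> : x^-1 / -1 * (y - x) = 1 - y / x by field; rewrite gt_eqF.
    lra.
have [_|s1] := eqVneq s 1.
  have := ln_le_subr1 (x / y) (divr_gt0 x0 y0).
  rewrite ln_div // -(ler_pM2l y0) => h.
  have e : y * (x / y - 1) = x - y by field; rewrite gt_eqF.
  rewrite e in h; nra.
have s10 : s - 1 != 0 by rewrite subr_eq0.
have := expR_bernoulli s (ln (y / x)) s0 s1.
have yx : 0 < y / x by rewrite divr_gt0.
rewrite lnK ?posrE //.
have -> : expR (s * ln (y / x)) = y `^ s / x `^ s.
  by rewrite ln_div // /powR !gt_eqF // mulrBr expRB.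
have X : 0 < x `^ s by rewrite powR_gt0.
rewrite -(pmulr_rge0 _ X) => h; rewrite -subr_ge0.
rewrite powR_subr1 //.
move: h; congr (0 <= _); field; rewrite s0 s10 !gt_eqF //.
Qed.

Lemma Omega_gen_subgradient s : subgradient_on_pos (Omega_gen s) (Omega_dgen s).
Proof. exact/subgradient_perspective/phi_subgradient. Qed.

Lemma Omega_gen1 s : Omega_gen s 1 = 0.
Proof.
rewrite /Omega_gen /phi -[1 + 1]/2 mulr1 divff ?pnatr_eq0 // powR1 ln1.
by case: ifP => _; [|case: ifP => _]; rewrite ?oppr0 ?mulr0 // subrr mul0r mulr0.
Qed.

(** * The means as difference quotients *)

(** Homogeneity removes the factor [2 `^ (- s)] of [AOmega]. *)
Lemma LpowM p c a b : 0 < c -> 0 < a -> 0 < b ->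
  Lpow p (c * a) (c * b) = c `^ p * Lpow p a b.
Proof.
move=> c0 a0 b0; rewrite /Lpow; case: ifP => [/eqP->|pN1].
  rewrite !lnM // powR_inv1 ?(ltW c0) // -mulrBr invfM.
  by rewrite opprD addrACA subrr add0r mulrCA.
have p1 : p + 1 != 0 by rewrite addr_eq0 pN1.
rewrite !powRM ?(ltW c0) ?(ltW a0) ?(ltW b0) // -!mulrBr.
have -> : c `^ p = c `^ (p + 1) / c by rewrite -powR_subr1 // addrK.
have [->|ba] := eqVneq (b - a) 0; first by rewrite !(mulr0,invr0).
by field; rewrite p1 ba gt_eqF.
Qed.

(** [Lpow p a b] is the average of [w `^ p] over [[a, b]], and [w `^ (s - 2)] is
    the second derivative of [phi s]. *)
Lemma Lpow_dphi s a b : Lpow (s - 2) a b = (dphi s b - dphi s a) / (b - a).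
Proof.
rewrite /Lpow /dphi.
have -> : (s - 2 == -1) = (s == 1).
  by rewrite subr_eq [-1 + 2](_ : _ = 1 :> K) //; ring.
case: ifP => s1; first by congr (_ / _); ring.
have -> : s - 2 + 1 = s - 1 by ring.
by rewrite -mulrBl invfM mulrA.
Qed.

(** Likewise [w `^ (s - 1)] is [w] times the second derivative of [phi s], an
    antiderivative of which is the Legendre transform of [phi s]. *)
Lemma Lpow_legendre s a b : 0 < a -> 0 < b ->
  Lpow (s - 1) a b
  = ((b * dphi s b - phi s b) - (a * dphi s a - phi s a)) / (b - a).
Proof.
move=> a0 b0; rewrite /Lpow /phi /dphi subrK.
rewrite subr_eq addNr.
have [->|s0] := eqVneq s 0.
  rewrite eq_sym oner_eq0 sub0r !powR_inv1 ?(ltW a0) ?(ltW b0) //.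
  by congr (_ / _); field; rewrite !gt_eqF.
have [->|s1] := eqVneq s 1.
  by rewrite !powRr1 ?(ltW a0) ?(ltW b0) // mul1r; congr (_ / _); ring.
rewrite [LHS](_ : _ = (b `^ s - a `^ s) / s / (b - a)); last by rewrite invfM mulrA.
congr (_ / _).
have s10 : s - 1 != 0 by rewrite subr_eq0.
rewrite !powR_subr1 //.
by field; rewrite s0 s10 !gt_eqF.
Qed.

Lemma AOmegaE s r R : 0 < r -> r < R ->
  AOmega s r R = (R - r) * (Omega_dgen s R - Omega_dgen s r) / 4.
Proof.
move=> r0 rR; have R0 := lt_trans r0 rR.
rewrite /AOmega /Omega_dgen.
have dbl z : 0 < z -> (z + 1) / z = 2 * ((z + 1) / (2 * z)).
  by move=> z0; field; rewrite gt_eqF.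
rewrite !dbl // !LpowM ?mean_ratio_gt0 //.
rewrite Lpow_legendre ?mean_ratio_gt0 // Lpow_dphi.
rewrite !powRB ?pnatr_eq0 ?implybT // powRN powRr1 // (powR_mulrn 2) //.
have T : 0 < (2 : K) `^ s by rewrite powR_gt0.
move: (phi _ _) (dphi _ _) (phi _ _) (dphi _ _) => F dF f df.
field; apply/and4P; split; rewrite ?(gt_eqF r0, gt_eqF R0, gt_eqF T) //.
have -> : (R + 1) * r + - (r + 1) * R = r - R by ring.
by rewrite subr_eq0 lt_eqF.
Qed.

Lemma BOmegaE s r R : 0 < r -> r < R ->
  BOmega s r R = ((R - 1) * Omega_gen s r + (1 - r) * Omega_gen s R) / (R - r).
Proof.
move=> r0 rR; have R0 := lt_trans r0 rR.
have wr := mean_ratio_gt0 _ _ r0; have wR := mean_ratio_gt0 _ _ R0.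
have Rr : R - r != 0 by rewrite subr_eq0 gt_eqF.
have Dw : (R + 1) / (2 * R) - (r + 1) / (2 * r) = - (R - r) / (2 * r * R).
  by field; rewrite !gt_eqF.
rewrite /BOmega /Lpow subrK subr_eq addNr eqxx Dw /Omega_gen /phi.
have [_|s0] := eqVneq s 0.
  by field; rewrite Rr !gt_eqF.
have [_|s1] := eqVneq s 1.
  have -> : (R + 1) * (r + 1) / (4 * r * R)
            = ((R + 1) / (2 * R)) * ((r + 1) / (2 * r)).
    by field; rewrite !gt_eqF.
  by rewrite (lnM wR wr); field; rewrite Rr !gt_eqF.
have s10 : s - 1 != 0 by rewrite subr_eq0.
by field; rewrite s0 s10 Rr !gt_eqF.
Qed.

End Generator.

(** * The divergences as sums over the generator *)

Section Identification.
Variables (K : realType) (n : nat) (P Q : 'I_n -> K).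
Hypotheses (hP : Gamma K n P) (hQ : Gamma K n Q).

Let P0 i : 0 < P i. Proof. exact: hP.1. Qed.
Let Q0 i : 0 < Q i. Proof. exact: hQ.1. Qed.

Let mean_ratioE i :
  (P i / Q i + 1) / (2 * (P i / Q i)) = (P i + Q i) / (2 * P i).
Proof. by field; rewrite !gt_eqF. Qed.

Lemma OmegaE s : Omega s P Q = \sum_i Q i * Omega_gen s (P i / Q i).
Proof.
have genE i : Q i * Omega_gen s (P i / Q i) = P i * phi s ((P i + Q i) / (2 * P i)).
  by rewrite /Omega_gen mean_ratioE; field; rewrite gt_eqF.
under [RHS]eq_bigr do rewrite genE.
rewrite /Omega /phi; case: ifP => [_|s0].
  apply: eq_bigr => i _; rewrite -lnV ?posrE ?invf_div //.
  by rewrite divr_gt0 ?addr_gt0 ?mulr_gt0.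
case: ifP => [_|s1].
  by apply: eq_bigr => i _; field; rewrite gt_eqF.
have -> : \sum_i P i * ((P i + Q i) / (2 * P i)) `^ s - 1
          = \sum_i (P i * ((P i + Q i) / (2 * P i)) `^ s - P i).
  by rewrite sumrB hP.2.
rewrite mulr_sumr; apply: eq_bigr => i _.
by field; rewrite subr_eq0 s0 s1.
Qed.

(** Multiples of [P i - Q i] sum to zero, so the derivative of the generator
    matters only up to an additive constant. *)
Lemma eq_sum_mod_diff (F G : 'I_n -> K) c :
  (forall i, F i = G i + c * (P i - Q i)) -> \sum_i F i = \sum_i G i.
Proof.
move=> FG; rewrite (eq_bigr _ (fun i _ => FG i)) big_split /= -mulr_sumr.
by rewrite sumrB hP.2 hQ.2 subrr mulr0 addr0.
Qed.

Lemma EOmegaE s :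
  EOmega s P Q = \sum_i Q i * ((P i / Q i - 1) * Omega_dgen s (P i / Q i)).
Proof.
have PQ i : P i + Q i != 0 by rewrite gt_eqF ?addr_gt0.
have dgenE i : Q i * ((P i / Q i - 1) * Omega_dgen s (P i / Q i))
    = (P i - Q i) * (phi s ((P i + Q i) / (2 * P i))
                     - Q i * dphi s ((P i + Q i) / (2 * P i)) / (2 * P i)).
  by rewrite /Omega_dgen mean_ratioE; field; rewrite !gt_eqF.
under [RHS]eq_bigr do rewrite dgenE.
have w0 i : 0 < (P i + Q i) / (2 * P i).
  by rewrite divr_gt0 ?addr_gt0 ?mulr_gt0.
rewrite /EOmega /phi /dphi /Ddiv /Delta /chi2.
have [->|s0] := eqVneq s 0.
  rewrite eq_sym oner_eq0 mulr_sumr -sumrB.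
  (* [(p - q) * q / (p + q) = (p - q) / 2 - (p - q) ^+ 2 / (2 * (p + q))] *)
  apply: (@eq_sum_mod_diff _ _ (- (1 / 2))) => i.
  rewrite sub0r powR_inv1 ?(ltW (w0 i)) // [Q i + P i]addrC.
  by field; rewrite PQ gt_eqF.
have [_|s1] := eqVneq s 1.
  rewrite -sumrB mulr_sumr.
  (* [- q / (2 * p) = (p - q) / (2 * p) - 1 / 2] *)
  apply: (@eq_sum_mod_diff _ _ (1 / 2)) => i.
  by rewrite [Q i + P i]addrC; field; rewrite gt_eqF.
have s10 : s - 1 != 0 by rewrite subr_eq0.
rewrite mulr_sumr.
(* The constant compensates the term [- 1] in the numerator of [phi s]. *)
apply: (@eq_sum_mod_diff _ _ (s * (s - 1))^-1) => i.
rewrite powR_subr1 //.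
by field; rewrite PQ s0 s10 !gt_eqF.
Qed.

End Identification.

Theorem theorem4 (K : realType) (n : nat) (hn : (2 <= n)%N)
    (P Q : 'I_n -> K) (hP : Gamma K n P) (hQ : Gamma K n Q)
    (r R : K) (hr0 : 0 < r) (hr1 : r < 1) (hR1 : 1 < R)
    (hPQ : forall i : 'I_n, r <= P i / Q i <= R) (s : K) :
  (Omega s P Q <= EOmega s P Q <= AOmega s r R) /\
  (Omega s P Q <= BOmega s r R <= AOmega s r R).
Proof.
have rR := lt_trans hr1 hR1.
have [P0 P1] := hP; have [Q0 Q1] := hQ.
have QP : \sum_i Q i * (P i / Q i) = 1.
  by rewrite -P1; apply: eq_bigr => i _; rewrite mulrC divfK ?gt_eqF.
have tf := @Omega_gen_subgradient K s; have f1 := Omega_gen1 s.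
rewrite (OmegaE _ _ _ _ hP hQ) (EOmegaE _ _ _ _ hP hQ) AOmegaE // BOmegaE //.
split; apply/andP; split.
- by apply: fdiv_le_gradient hPQ tf f1.
- by apply: gradient_le_gruss hPQ tf.
- by apply: fdiv_le_chord hPQ tf.
- by apply: chord_le_gruss tf f1.
Qed.
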